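(* Let $c\in[1,3)$, $T\in[0,+\infty)$ and $\sigma\in\mathbb{R}_+$. Let $u$ and $\tilde u$ be two solutions of the dyadic system on $[0,T]$ with the same initial condition $\underline{u}\in H_+$ and the same noise $w\in C([0,T],\mathbb{R})$ with $w(0)=0$. Then $u(t)=\tilde u(t)$ for all $t\in[0,T]$.
   Context: Sequences $u=(u_j)_{j\ge0}$ are real and indexed by $j\ge 0$. $\mathbb{R}_+=[0,\infty)$. $H_+=\{u\in\ell^2: u_j\ge 0 \text{ for all } j\ge1\}$ (no sign condition on $u_0$). Dyadic system (with parameters $\sigma,c$, initial condition $\underline{u}$ and noise $w$): $$\left\{\begin{array}{ll} u_0(t)=u_0(0)-\int_0^t u_1(s)u_0(s)\,ds+\sigma w(t) & \\ \frac{d}{dt}u_j=-2^{cj}u_ju_{j+1}+2^{c(j-1)}u_{j-1}^2 & \text{for } j\ge1\\ u(0)=\underline{u} & \end{array}\right.\qquad t\in[0,T].$$ A solution on $[0,T]$ with initial condition $\underline{u}\in H_+$ and noise $w\in C([0,T],\mathbb{R})$, $w(0)=0$, is a $u=(u_j)_{j\ge0}$ satisfying this system with $u_j\in C([0,T],\mathbb{R})$ for all $j$ and $u(t)\in H_+$ for all $t\in[0,T]$. *)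

(* Defs.v *)
From Stdlib Require Import Reals.
From Coquelicot Require Import Coquelicot.
Open Scope R_scope.

Definition Icc (a b : R) : R -> Prop := fun t => a <= t <= b.

Definition ell2 (x : nat -> R) : Prop := ex_series (fun j => x j ^ 2).

Definition H_plus (x : nat -> R) : Prop :=
  ell2 x /\ forall j : nat, (1 <= j)%nat -> 0 <= x j.

(* [u t j] is u_j(t).  An element of C([0,T], R) is represented by a total
   function on R, of which only the values on [0,T] are constrained.
   [D_in f d D t] says that f has derivative [d t] at t along D, so the
   derivative is one-sided at the endpoints of [0,T].  The integrand is
   continuous on [0,t], so [RInt] is a genuine Riemann integral. *)
Record dyadic_solution (c sigma T : R) (u0 : nat -> R) (w : R -> R)
    (u : R -> nat -> R) : Prop := {
  dyadic_zero : forall t, Icc 0 T t ->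
    u t 0%nat =
      u 0 0%nat - RInt (fun s => u s 1%nat * u s 0%nat) 0 t + sigma * w t;
  dyadic_deriv : forall j : nat, (1 <= j)%nat -> forall t, Icc 0 T t ->
    D_in (fun s => u s j)
      (fun s => - Rpower 2 (c * INR j) * u s j * u s (j + 1)%nat
                + Rpower 2 (c * (INR j - 1)) * u s (j - 1)%nat ^ 2)
      (Icc 0 T) t;
  dyadic_init : forall j : nat, u 0 j = u0 j;
  dyadic_cont : forall j : nat, continuous_on (Icc 0 T) (fun t => u t j);
  dyadic_H_plus : forall t, Icc 0 T t -> H_plus (u t)
}.

(* Main.v *)
Require Import Defs.
From Stdlib Require Import Reals Lra Lia.
From Coquelicot Require Import Coquelicot.
Open Scope R_scope.

(** Put [q = 2^c], [z_j = u_j - v_j] and [s_j = u_j + v_j].  In the derivative of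
    [2^-j z_j^2] the terms that couple neighbouring modes telescope:
    [[
      (2^-j z_j^2)' = - (q/2)^j z_j^2 s_{j+1} + G_{j-1} - G_j,
      G_j = (q/2)^j (u_j^2 - v_j^2) (u_{j+1} - v_{j+1}),
    ]]
    and [s_{j+1} >= 0]; for [j = 0] the noise cancels in [z_0] and the same holds
    without [G_{-1}].  Hence [int_0^t G_j] is nonincreasing in [j] and
    [2^-j z_j(t)^2 <= - int_0^t G_j <= - int_0^t G_n] for every [n >= j]
    ([gap_step]).  Since
    [- G_n <= (q/2)^n (u_n^3 + u_{n+1}^3 + v_n^3 + v_{n+1}^3)], it is enough to show
    that [q^n int_0^T u_n^3] is bounded in [n] ([cube_integral_bound]): the factor
    [2^-n] then sends the right-hand side to zero.

    For that bound, the energy balance of the modes [1, ..., n] shows that the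
    fluxes [q^n int_0^T u_n^2 u_{n+1}] and the modes [u_n] are bounded, uniformly in
    [n >= 1] and in time ([energy_bound]); the forcing only enters through
    [int_0^T u_0^2 u_1], which is finite because [u_0] and [u_1] are
    continuous.  Integrating the equation of [u_n u_{n+1}], whose right-hand side
    contains [q^n u_n^3], and applying Young's inequality to the negative terms
    gives, for [x_n = q^n int_0^T u_n^3],
    [[
      x_n <= D + d (x_n + x_{n+1} + x_{n+2})
    ]]
    with [d] as small as desired ([cube_integral_recursion]).  As [x_n <= A q^n] by the
    uniform bound on [u_n], iterating this inequality yields [x_n <= 2 D]
    ([le_of_absorbed_recursion]).

    Functions are extended beyond [[0,T]] by their values at the endpoints, so
    that they are continuous on the whole line, while the differential
    equations are only used on the open interval. *)

(** * Integration of differential inequalities *)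

Lemma ex_RInt_everywhere_continuous (f : R -> R) (a b : R) :
  (forall x, continuous f x) -> ex_RInt f a b.
Proof.
  intros Hf. apply (ex_RInt_continuous (V := R_CompleteNormedModule)).
  intros; apply Hf.
Qed.

Lemma continuous_Rplus (f g : R -> R) (x : R) :
  continuous f x -> continuous g x -> continuous (fun y => f y + g y) x.
Proof. exact (continuous_plus (V := R_NormedModule) f g x). Qed.

Lemma continuous_Ropp (f : R -> R) (x : R) :
  continuous f x -> continuous (fun y => - f y) x.
Proof. exact (continuous_opp (V := R_NormedModule) f x). Qed.

Lemma continuous_Rminus (f g : R -> R) (x : R) :
  continuous f x -> continuous g x -> continuous (fun y => f y - g y) x.
Proof. exact (continuous_minus (V := R_NormedModule) f g x). Qed.

Lemma continuous_Rmult (f g : R -> R) (x : R) :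
  continuous f x -> continuous g x -> continuous (fun y => f y * g y) x.
Proof. exact (continuous_mult (K := R_AbsRing) f g x). Qed.

Lemma continuous_Rconst (a x : R) : continuous (fun _ : R => a) x.
Proof. apply continuous_const. Qed.

(** Proves continuity of sums and products of functions whose continuity is
    among the hypotheses. *)
Ltac cont :=
  cbv beta;
  repeat match goal with
    | |- continuous (fun x => @?f x + @?g x) _ => apply (continuous_Rplus f g); cbv beta
    | |- continuous (fun x => @?f x - @?g x) _ => apply (continuous_Rminus f g); cbv beta
    | |- continuous (fun x => - @?f x) _ => apply (continuous_Ropp f); cbv beta
    | |- continuous (fun x => @?f x * @?g x) _ => apply (continuous_Rmult f g); cbv beta
    | |- continuous (fun _ => ?a) ?y => apply (continuous_Rconst a y)
    | H : forall x, continuous ?f x |- continuous ?f _ => apply H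
    | H : forall x, continuous ?f x |- continuous (fun x => ?f x) _ => apply H
    | H : forall i x, continuous (?U i) x |- continuous (?U _) _ => apply H
    | H : forall i x, continuous (?U i) x |- continuous (fun x => ?U _ x) _ => apply H
    end.

Lemma RInt_linear_combination (a b : R) (f g : R -> R) (s t : R) :
  (forall x, continuous f x) -> (forall x, continuous g x) ->
  RInt (fun x => a * f x + b * g x) s t = a * RInt f s t + b * RInt g s t.
Proof.
  intros Hf Hg. apply is_RInt_unique.
  apply (is_RInt_plus (V := R_NormedModule)).
  - apply (is_RInt_scal (V := R_NormedModule)).
    apply (RInt_correct (V := R_CompleteNormedModule)).
    now apply ex_RInt_everywhere_continuous.
  - apply (is_RInt_scal (V := R_NormedModule)).
    apply (RInt_correct (V := R_CompleteNormedModule)).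
    now apply ex_RInt_everywhere_continuous.
Qed.

Lemma RInt_nonneg_le_mono (f : R -> R) (t T : R) :
  (forall x, continuous f x) -> (forall x, 0 <= f x) -> 0 <= t <= T ->
  0 <= RInt f 0 t <= RInt f 0 T.
Proof.
  intros Hf Hp Ht.
  assert (E : forall a b, ex_RInt f a b)
    by (intros; now apply ex_RInt_everywhere_continuous).
  assert (C : RInt f 0 t + RInt f t T = RInt f 0 T)
    by (apply (RInt_Chasles (V := R_CompleteNormedModule)); apply E).
  assert (H1 : 0 <= RInt f 0 t) by (apply RInt_ge_0; [lra | auto | auto]).
  assert (H2 : 0 <= RInt f t T) by (apply RInt_ge_0; [lra | auto | auto]).
  lra.
Qed.

Lemma is_derive_RInt_everywhere_continuous (f : R -> R) (a x : R) :
  (forall x, continuous f x) -> is_derive (RInt f a) x (f x).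
Proof.
  intros Hf. apply (is_derive_RInt (V := R_NormedModule)) with a.
  - exists (mkposreal 1 Rlt_0_1). intros y _.
    apply (RInt_correct (V := R_CompleteNormedModule)).
    now apply ex_RInt_everywhere_continuous.
  - apply Hf.
Qed.

(** Nothing is asked of [f] at the endpoints beyond continuity, which is what
    makes one-sided derivatives at [0] and [T] irrelevant. *)
Lemma increment_le_RInt (f df g : R -> R) (T t : R) :
  (forall x, 0 < x < T -> is_derive f x (df x)) ->
  (forall x, continuous f x) -> (forall x, continuous g x) ->
  (forall x, df x <= g x) ->
  0 <= t <= T ->
  f t - f 0 <= RInt g 0 t.
Proof.
  intros Hd Cf Cg Hle Ht.
  destruct (MVT_gen (fun x => RInt g 0 x - f x) 0 t (fun x => g x - df x))
    as [x [Hx E]].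
  - rewrite Rmin_left, Rmax_right by lra. intros x Hx.
    apply (is_derive_minus (V := R_NormedModule)); [|apply Hd; lra].
    now apply is_derive_RInt_everywhere_continuous.
  - intros x _. apply continuity_pt_filterlim.
    apply (continuous_minus (V := R_NormedModule)); [|apply Cf].
    apply (ex_derive_continuous (V := R_NormedModule)).
    exists (g x). now apply is_derive_RInt_everywhere_continuous.
  - cbv beta in E.
    assert (Z : RInt g 0 0 = 0)
      by apply (RInt_point (V := R_CompleteNormedModule)).
    rewrite Z in E.
    pose proof (Hle x).
    assert (0 <= (g x - df x) * (t - 0)) by (apply Rmult_le_pos; lra).
    lra.
Qed.

(** * Positive cascades *)

(** The modes [U 1, U 2, ...] solve the dyadic equations with ratio [q] inside
    [(0,T)].  The driving mode [U 0] is an arbitrary continuous function of any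
    sign.  Continuity and positivity are required at all real times, which
    loses no generality since functions on [[0,T]] can be extended by their
    endpoint values. *)
Record positive_cascade (q T : R) (U : nat -> R -> R) : Prop := {
  cascade_cont : forall j x, continuous (U j) x;
  cascade_pos : forall j x, 0 <= U (S j) x;
  cascade_deriv : forall j x, 0 < x < T ->
    is_derive (U (S j)) x
      (- q ^ S j * U (S j) x * U (S (S j)) x + q ^ j * (U j x * U j x))
}.

(** Half the energy transferred from mode [j] to mode [j + 1] up to time [t]. *)
Definition energy_flux (q : R) (U : nat -> R -> R) (j : nat) (t : R) : R :=
  q ^ j * RInt (fun s => U j s * U j s * U (S j) s) 0 t.

Lemma energy_flux_mono q T U j t : 1 <= q ->
  positive_cascade q T U -> 0 <= t <= T -> 0 <= energy_flux q U j t <= energy_flux q U j T.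
Proof.
  intros Hq [C P D] Ht. unfold energy_flux.
  assert (0 < q ^ j) by (apply pow_lt; lra).
  destruct (RInt_nonneg_le_mono (fun s => U j s * U j s * U (S j) s) t T) as [H1 H2].
  - intros; cont.
  - intros x. apply Rmult_le_pos; [apply Rle_0_sqr | apply P].
  - exact Ht.
  - split; [apply Rmult_le_pos; lra | apply Rmult_le_compat_l; lra].
Qed.

(** Energy balance of the mode [j + 1]; it is in fact an equality. *)
Lemma energy_step q T U j t :
  positive_cascade q T U -> 0 <= t <= T ->
  2 * energy_flux q U (S j) t + U (S j) t ^ 2
    <= U (S j) 0 ^ 2 + 2 * energy_flux q U j t.
Proof.
  intros [C P D] Ht. unfold energy_flux.
  pose proof (increment_le_RInt (fun x => U (S j) x * U (S j) x)
    (fun x => (- q ^ S j * U (S j) x * U (S (S j)) x + q ^ j * (U j x * U j x))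
         * U (S j) x
       + U (S j) x * (- q ^ S j * U (S j) x * U (S (S j)) x + q ^ j * (U j x * U j x)))
    (fun x => (2 * q ^ j) * (U j x * U j x * U (S j) x)
         + (- 2 * q ^ S j) * (U (S j) x * U (S j) x * U (S (S j)) x)) T t) as H.
  rewrite RInt_linear_combination in H by (intros; cont).
  cbv beta in H.
  assert (H' : U (S j) t * U (S j) t - U (S j) 0 * U (S j) 0 <=
    2 * q ^ j * RInt (fun x => U j x * U j x * U (S j) x) 0 t +
    -2 * q ^ S j * RInt (fun x => U (S j) x * U (S j) x * U (S (S j)) x) 0 t).
  { apply H; try (intros; cont; fail); [|intros; apply Req_le; ring|lra].
    intros x Hx. apply (is_derive_mult (U (S j)) (U (S j)));
      [now apply D|now apply D|]. intros; apply Rmult_comm. }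
  lra.
Qed.

Lemma energy_bound q T U : 1 <= q -> 0 <= T ->
  positive_cascade q T U -> ell2 (fun j => U j 0) ->
  exists K, 1 <= K /\ (forall j, energy_flux q U j T <= K) /\
    (forall j t, 0 <= t <= T -> U (S j) t <= K).
Proof.
  intros Hq HT HU HE.
  set (S0 := Series (fun j => U j 0 ^ 2)).
  assert (PS : forall n, sum_f_R0 (fun j => U j 0 ^ 2) n <= S0).
  { intros n. apply sum_incr; [|intros; apply pow2_ge_0].
    apply is_series_Reals. now apply Series_correct. }
  assert (HS : 0 <= S0) by (eapply Rle_trans; [|apply (PS O)]; simpl; nra).
  assert (A : forall n t, 0 <= t <= T ->
     2 * energy_flux q U n t <= 2 * energy_flux q U O T + sum_f_R0 (fun j => U j 0 ^ 2) n).
  { intros n t Ht. induction n.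
    - destruct (energy_flux_mono q T U O t Hq HU Ht). simpl. nra.
    - pose proof (energy_step q T U n t HU Ht) as H.
      pose proof (pow2_ge_0 (U (S n) t)).
      change (sum_f_R0 (fun j => U j 0 ^ 2) (S n)) with
       (sum_f_R0 (fun j => U j 0 ^ 2) n + U (S n) 0 ^ 2). lra. }
  assert (F0 : 0 <= energy_flux q U O T) by (apply (energy_flux_mono q T U O T); auto; lra).
  (* The summand 1 turns a bound on [U^2] into a bound on [U]. *)
  exists (2 * energy_flux q U O T + S0 + 1). repeat split.
  - lra.
  - intros n. specialize (A n T). specialize (PS n). lra.
  - intros j t Ht.
    pose proof (energy_step q T U j t HU Ht) as H.
    destruct (energy_flux_mono q T U (S j) t Hq HU Ht) as [G _].
    specialize (A j t Ht). specialize (PS (S j)).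
    change (sum_f_R0 (fun j => U j 0 ^ 2) (S j)) with
       (sum_f_R0 (fun j => U j 0 ^ 2) j + U (S j) 0 ^ 2) in PS.
    destruct (Rle_lt_dec (U (S j) t) 1); nra.
Qed.

(** * Uniform bound on the integrals of cubes *)

(** The cube of [U j], integrated over [[0,T]] and scaled by the rate [q^j] of the
    mode [j]. *)
Definition cube_integral (q : R) (U : nat -> R -> R) (j : nat) (T : R) : R :=
  q ^ j * RInt (fun s => U j s * U j s * U j s) 0 T.

Lemma young_square a b e : 0 < e -> 0 <= a -> 0 <= b ->
  a * (b * b) <= / (4 * e) * (a * a * b) + e * (b * b * b).
Proof.
  intros He Ha Hb.
  assert (H : / (4 * e) * (a * a * b) + e * (b * b * b) - a * (b * b)
    = / (4 * e) * b * ((a - 2 * e * b) * (a - 2 * e * b))) by (field; lra).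
  assert (0 <= / (4 * e) * b * ((a - 2 * e * b) * (a - 2 * e * b))).
  { apply Rmult_le_pos; [apply Rmult_le_pos; [|lra]|apply Rle_0_sqr].
    left; apply Rinv_0_lt_compat; lra. }
  lra.
Qed.

Lemma sqr_mul_le_cubes a b : 0 <= a -> 0 <= b ->
  a * a * b <= a * a * a + b * b * b.
Proof.
  intros Ha Hb.
  assert (0 <= a * a * a) by (repeat apply Rmult_le_pos; lra).
  assert (0 <= b * b * b) by (repeat apply Rmult_le_pos; lra).
  destruct (Rle_lt_dec b a).
  - assert (a * a * b <= a * a * a) by (apply Rmult_le_compat_l; nra). lra.
  - assert (a * a * b <= b * b * b) by (apply Rmult_le_compat; nra). lra.
Qed.

Lemma young_triple a b d e : 0 < e -> 0 <= a -> 0 <= b -> 0 <= d ->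
  a * b * d <= / (4 * e) * (b * b * d) + e * (a * a * a + d * d * d).
Proof.
  intros He Ha Hb Hd.
  assert (H : / (4 * e) * (b * b * d) + e * (a * a * d) - a * b * d
    = / (4 * e) * d * ((b - 2 * e * a) * (b - 2 * e * a))) by (field; lra).
  assert (0 <= / (4 * e) * d * ((b - 2 * e * a) * (b - 2 * e * a))).
  { apply Rmult_le_pos; [apply Rmult_le_pos; [|lra]|apply Rle_0_sqr].
    left; apply Rinv_0_lt_compat; lra. }
  pose proof (sqr_mul_le_cubes a d Ha Hd).
  assert (e * (a * a * d) <= e * (a * a * a + d * d * d))
    by (apply Rmult_le_compat_l; lra).
  lra.
Qed.

(** This bound grows with [j]; it only serves to start the iteration. *)
Lemma cube_integral_crude_bound q T U K : 1 <= q -> 0 <= T ->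
  positive_cascade q T U ->
  (forall j t, 0 <= t <= T -> U (S j) t <= K) ->
  forall j, cube_integral q U (S j) T <= T * K ^ 3 * q ^ S j.
Proof.
  intros Hq HT [C P D] HK j. unfold cube_integral.
  rewrite (Rmult_comm _ (q ^ S j)). apply Rmult_le_compat_l; [apply pow_le; lra|].
  assert (E : RInt (fun _ : R => K ^ 3) 0 T = T * K ^ 3).
  { rewrite (RInt_const (V := R_CompleteNormedModule)).
    unfold scal; simpl; unfold mult; simpl. ring. }
  rewrite <- E. apply RInt_le; [lra | | |].
  - apply ex_RInt_everywhere_continuous. intros; cont.
  - apply ex_RInt_everywhere_continuous. intros; cont.
  - intros x Hx. specialize (P j x). specialize (HK j x).
    replace (K ^ 3) with (K * K * K) by ring.
    assert (U (S j) x <= K) by (apply HK; lra).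
    apply Rmult_le_compat; try nra.
Qed.

(** Integrated form of the equation of [U_n U_{n+1}], [n = j + 1]:
    [[
      (U_n U_{n+1})' = q^n U_n^3 - q^n U_n U_{n+1}^2
                       - q^{n+1} U_n U_{n+1} U_{n+2} + q^{n-1} U_{n-1}^2 U_{n+1}.
    ]]
    The last term has a favourable sign and is dropped; the two negative terms
    are split by Young's inequality into energy fluxes, which are bounded, and
    cubes with the small coefficient [e]. *)
Lemma cube_integral_recursion q T U K e : 1 <= q -> 0 <= T -> 0 < e -> 1 <= K ->
  positive_cascade q T U ->
  (forall j, energy_flux q U j T <= K) ->
  (forall j t, 0 <= t <= T -> U (S j) t <= K) ->
  forall j, cube_integral q U (S j) T <= K ^ 2 + / (4 * e) * (2 * K)
    + e * q * (cube_integral q U (S j) T + cube_integral q U (S (S j)) T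
               + cube_integral q U (S (S (S j))) T).
Proof.
  intros Hq HT He HK1 HU HF HK j.
  pose proof HU as [C P D].
  set (n := S j).
  pose (k := / (4 * e)).
  assert (Hk : 0 < k) by (apply Rinv_0_lt_compat; lra).
  assert (Hqn : 0 < q ^ n) by (apply pow_lt; lra).
  pose (X := fun (i : nat) (s : R) => U i s * U i s * U i s).
  pose (Y := fun (i : nat) (s : R) => U i s * U i s * U (S i) s).
  assert (CX : forall i x, continuous (X i) x) by (intros; unfold X; cont).
  assert (CY : forall i x, continuous (Y i) x) by (intros; unfold Y; cont).
  assert (PX : forall i, 0 <= RInt (X (S i)) 0 T).
  { intros i. apply (RInt_nonneg_le_mono (X (S i)) T T); [apply CX | |lra].
    intros x. specialize (P i x). unfold X. repeat apply Rmult_le_pos; lra. }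
  pose (dU := fun i x => - q ^ S i * U (S i) x * U (S (S i)) x + q ^ i * (U i x * U i x)).
  assert (M : - (U n T * U (S n) T) - - (U n 0 * U (S n) 0) <=
    RInt (fun s => 1 * (1 * (1 * ((e * q - 1) * q ^ n * X n s + e * q ^ n * X (S n) s)
        + e * q ^ S n * X (S (S n)) s) + k * q ^ n * Y n s) + k * q ^ S n * Y (S n) s) 0 T).
  { apply (increment_le_RInt (fun x => - (U n x * U (S n) x))
      (fun x => - (dU j x * U (S n) x + U n x * dU n x)) _ T T).
    - intros x Hx. apply (is_derive_opp (V := R_NormedModule) (fun y => U n y * U (S n) y)).
      apply (is_derive_mult (U n) (U (S n)));
        [now apply D|now apply D|]. intros; apply Rmult_comm.
    - intros; cont.
    - intros; cont.
    - intros x. unfold dU, X, Y. fold n.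
      pose proof (P j x) as p0. pose proof (P n x) as p1. pose proof (P (S n) x) as p2.
      fold n in p0.
      pose proof (young_square _ _ e He p0 p1) as I1. fold k in I1.
      pose proof (young_triple _ _ _ e He p0 p1 p2) as I2. fold k in I2.
      assert (0 <= q ^ j * (U j x * U j x) * U (S n) x).
      { apply Rmult_le_pos; [apply Rmult_le_pos; [apply pow_le; lra|apply Rle_0_sqr]|lra]. }
      apply (Rmult_le_compat_l (q ^ n)) in I1; [|lra].
      apply (Rmult_le_compat_l (q ^ S n)) in I2; [|apply pow_le; lra].
      change (q ^ S n) with (q * q ^ n) in *.
      lra.
    - lra. }
  rewrite (RInt_linear_combination 1 (k * q ^ S n)) in M by (intros; cont).
  rewrite (RInt_linear_combination 1 (k * q ^ n)) in M by (intros; cont).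
  rewrite (RInt_linear_combination 1 (e * q ^ S n)) in M by (intros; cont).
  rewrite (RInt_linear_combination ((e * q - 1) * q ^ n) (e * q ^ n)) in M by (intros; cont).
  pose proof (HF n) as F1. pose proof (HF (S n)) as F2.
  change (energy_flux q U n T) with (q ^ n * RInt (Y n) 0 T) in F1.
  change (energy_flux q U (S n) T) with (q ^ S n * RInt (Y (S n)) 0 T) in F2.
  change (cube_integral q U n T) with (q ^ n * RInt (X n) 0 T).
  change (cube_integral q U (S n) T) with (q ^ S n * RInt (X (S n)) 0 T).
  change (cube_integral q U (S (S n)) T) with (q ^ S (S n) * RInt (X (S (S n))) 0 T).
  fold k.
  apply (Rmult_le_compat_l k) in F1; [|lra].
  apply (Rmult_le_compat_l k) in F2; [|lra].
  assert (B0 : 0 <= U n 0 * U (S n) 0) by (apply Rmult_le_pos; apply P).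
  assert (B1 : U n T * U (S n) T <= K ^ 2).
  { replace (K ^ 2) with (K * K) by ring.
    apply Rmult_le_compat; try apply P; apply HK; lra. }
  pose proof (PX n) as P1. pose proof (PX (S n)) as P2.
  assert (Q1 : q ^ n <= q * q ^ n).
  { rewrite <- (Rmult_1_l (q ^ n)) at 1. apply Rmult_le_compat_r; lra. }
  assert (Q2 : q * q ^ n <= q * (q * q ^ n)) by (apply Rmult_le_compat_l; lra).
  assert (Q3 : q * (q * q ^ n) <= q * (q * (q * q ^ n)))
    by (apply Rmult_le_compat_l; lra).
  pose proof (PX (S (S j))) as P3. fold n in P3.
  assert (R1 : 0 <= e * RInt (X (S n)) 0 T) by (apply Rmult_le_pos; lra).
  assert (R2 : 0 <= e * RInt (X (S (S n))) 0 T) by (apply Rmult_le_pos; lra).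
  apply (Rmult_le_compat_r _ _ _ R1) in Q1 as I1.
  apply (Rmult_le_compat_r _ _ _ R1) in Q2 as I2.
  apply (Rmult_le_compat_r _ _ _ R2) in Q2 as I3.
  apply (Rmult_le_compat_r _ _ _ R2) in Q3 as I4.
  change (q ^ S (S n)) with (q * (q * q ^ n)) in *.
  change (q ^ S n) with (q * q ^ n) in *.
  lra.
Qed.

(** By induction on [k], [x j <= 2 D + 2^-k |A| q^j]: each use of the recursion
    halves the growing part. *)
Lemma le_of_absorbed_recursion q (x : nat -> R) A D d :
  1 <= q -> 0 <= D -> 0 <= d -> d * (1 + q + q ^ 2) <= / 2 ->
  (forall j, x j <= A * q ^ j) ->
  (forall j, x j <= D + d * (x j + x (S j) + x (S (S j)))) ->
  forall j, x j <= 2 * D.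
Proof.
  intros Hq HD Hd Hsmall HA Hrec.
  assert (It : forall k j, x j <= 2 * D + (/ 2) ^ k * (Rabs A * q ^ j)).
  { induction k; intros j.
    - simpl. assert (A * q ^ j <= Rabs A * q ^ j)
        by (apply Rmult_le_compat_r; [apply pow_le; lra | apply Rle_abs]).
      specialize (HA j). lra.
    - pose proof (IHk j) as H0. pose proof (IHk (S j)) as H1.
      pose proof (IHk (S (S j))) as H2.
      specialize (Hrec j).
      set (y := (/ 2) ^ k * (Rabs A * q ^ j)) in *.
      assert (Hy : 0 <= y).
      { unfold y. apply Rmult_le_pos; [apply pow_le; lra|].
        apply Rmult_le_pos; [apply Rabs_pos|apply pow_le; lra]. }
      replace ((/ 2) ^ k * (Rabs A * q ^ S j)) with (q * y) in H1
        by (unfold y; simpl; ring).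
      replace ((/ 2) ^ k * (Rabs A * q ^ S (S j))) with (q ^ 2 * y) in H2
        by (unfold y; simpl; ring).
      replace ((/ 2) ^ S k * (Rabs A * q ^ j)) with (/ 2 * y)
        by (unfold y; simpl; ring).
      assert (d * (x j + x (S j) + x (S (S j))) <= d * (6 * D + (1 + q + q ^ 2) * y))
        by (apply Rmult_le_compat_l; lra).
      assert (d * (1 + q + q ^ 2) * y <= / 2 * y) by (apply Rmult_le_compat_r; lra).
      assert (0 <= d * (q - 1)) by (apply Rmult_le_pos; lra).
      assert (0 <= d * (q ^ 2 - 1)) by (apply Rmult_le_pos; nra).
      assert (6 * d * D <= 1 * D) by (apply Rmult_le_compat_r; lra).
      lra. }
  intros j. apply Rnot_lt_le. intros Hlt.
  destruct (pow_lt_1_zero (/ 2)) with (y := (x j - 2 * D) / (Rabs A * q ^ j + 1)) as [N HN].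
  - rewrite Rabs_pos_eq; lra.
  - assert (0 <= Rabs A * q ^ j) by (apply Rmult_le_pos; [apply Rabs_pos|apply pow_le; lra]).
    apply Rdiv_lt_0_compat; lra.
  - specialize (HN N (Nat.le_refl N)). specialize (It N j).
    assert (0 <= Rabs A * q ^ j) by (apply Rmult_le_pos; [apply Rabs_pos|apply pow_le; lra]).
    assert (0 < (/ 2) ^ N) by (apply pow_lt; lra).
    rewrite Rabs_pos_eq in HN by lra.
    apply (Rmult_lt_compat_r (Rabs A * q ^ j + 1)) in HN; [|lra].
    unfold Rdiv in HN. rewrite Rmult_assoc, Rinv_l in HN by lra. nra.
Qed.

Lemma cube_integral_bound q T U : 1 <= q -> 0 <= T ->
  positive_cascade q T U -> ell2 (fun j => U j 0) ->
  exists B, forall j, cube_integral q U (S j) T <= B.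
Proof.
  intros Hq HT HU HE.
  destruct (energy_bound q T U Hq HT HU HE) as [K [HK1 [HF HK]]].
  (* The coefficient [d = e q] then satisfies [d (1 + q + q^2) = 1/2]. *)
  pose (e := / (2 * (q * (1 + q + q ^ 2)))).
  assert (Hpos : 0 < q * (1 + q + q ^ 2)) by (apply Rmult_lt_0_compat; nra).
  assert (He : 0 < e) by (apply Rinv_0_lt_compat; lra).
  assert (Hk : 0 < / (4 * e)) by (apply Rinv_0_lt_compat; lra).
  exists (2 * (K ^ 2 + / (4 * e) * (2 * K))).
  apply (le_of_absorbed_recursion q _ (T * K ^ 3 * q) _ (e * q)).
  - exact Hq.
  - apply Rplus_le_le_0_compat; [nra | apply Rmult_le_pos; lra].
  - apply Rmult_le_pos; lra.
  - right. unfold e. field. nra.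
  - intros j. pose proof (cube_integral_crude_bound q T U K Hq HT HU HK j) as H.
    simpl in H |- *. lra.
  - apply (cube_integral_recursion q T U K e); assumption.
Qed.

(** * Uniqueness for positive cascades *)

(** The integral over [[0,t]] of the coupling term [G_j] between the modes [j] and
    [j + 1] in the evolution of the weighted squares [2^-j (U_j - V_j)^2]. *)
Definition gap_flux (q : R) (U V : nat -> R -> R) (j : nat) (t : R) : R :=
  (q / 2) ^ j *
  RInt (fun s => (U j s * U j s - V j s * V j s) * (U (S j) s - V (S j) s)) 0 t.

(** The weight [2^-j] is the one for which the cross terms
    [(U_j + V_j) (U_j - V_j) (U_{j+1} - V_{j+1})] produced by the equations of the
    modes [j] and [j + 1] cancel. *)
Lemma gap_step q T U V j t : 0 <= q ->
  positive_cascade q T U -> positive_cascade q T V ->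
  U (S j) 0 = V (S j) 0 -> 0 <= t <= T ->
  (/ 2) ^ S j * (U (S j) t - V (S j) t) ^ 2 + gap_flux q U V (S j) t
    <= gap_flux q U V j t.
Proof.
  intros Hq [CU PU DU] [CV PV DV] H0 Ht. unfold gap_flux.
  pose (h := (/ 2) ^ S j).
  pose (dU := fun x => - q ^ S j * U (S j) x * U (S (S j)) x + q ^ j * (U j x * U j x)).
  pose (dV := fun x => - q ^ S j * V (S j) x * V (S (S j)) x + q ^ j * (V j x * V j x)).
  pose (G := fun i s => (U i s * U i s - V i s * V i s) * (U (S i) s - V (S i) s)).
  assert (CG : forall i x, continuous (G i) x) by (intros; unfold G; cont).
  assert (M : h * ((U (S j) t - V (S j) t) * (U (S j) t - V (S j) t))
     - h * ((U (S j) 0 - V (S j) 0) * (U (S j) 0 - V (S j) 0)) <=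
    RInt (fun s => (q / 2) ^ j * G j s + - (q / 2) ^ S j * G (S j) s) 0 t).
  { apply (increment_le_RInt
      (fun x => h * ((U (S j) x - V (S j) x) * (U (S j) x - V (S j) x)))
      (fun x => h * ((dU x - dV x) * (U (S j) x - V (S j) x)
                     + (U (S j) x - V (S j) x) * (dU x - dV x))) _ T t).
    - intros x Hx.
      assert (DZ : is_derive (fun y => U (S j) y - V (S j) y) x (dU x - dV x)).
      { apply (is_derive_minus (V := R_NormedModule)); [now apply DU | now apply DV]. }
      apply (is_derive_scal (fun y => (U (S j) y - V (S j) y) * (U (S j) y - V (S j) y))).
      apply (is_derive_mult (fun y => U (S j) y - V (S j) y) (fun y => U (S j) y - V (S j) y));
        [exact DZ | exact DZ |]. intros; apply Rmult_comm.
    - intros; cont.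
    - intros; cont.
    - intros x. unfold h, dU, dV, G.
      assert (0 <= (/ 2) ^ S j * q ^ S j * ((U (S (S j)) x + V (S (S j)) x) *
         ((U (S j) x - V (S j) x) * (U (S j) x - V (S j) x)))).
      { specialize (PU (S j) x). specialize (PV (S j) x).
        apply Rmult_le_pos; [apply Rmult_le_pos; apply pow_le; lra|].
        apply Rmult_le_pos; [lra|apply Rle_0_sqr]. }
      unfold Rdiv. rewrite !Rpow_mult_distr.
      simpl (_ ^ S j) in *. lra.
    - exact Ht. }
  rewrite RInt_linear_combination in M by (intros; cont).
  rewrite H0 in M. fold (G j) (G (S j)). fold h. lra.
Qed.

Lemma gap_flux_lower q T U V j t : 1 <= q ->
  positive_cascade q T U -> positive_cascade q T V -> 0 <= t <= T ->
  - gap_flux q U V (S j) t <= (/ 2) ^ S j *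
    (cube_integral q U (S j) T + cube_integral q U (S (S j)) T
     + (cube_integral q V (S j) T + cube_integral q V (S (S j)) T)).
Proof.
  intros Hq HU HV Ht. pose proof HU as [CU PU DU]. pose proof HV as [CV PV DV].
  unfold gap_flux, cube_integral, Rdiv. rewrite Rpow_mult_distr.
  pose (X := fun i s => U i s * U i s * U i s).
  pose (Y := fun i s => V i s * V i s * V i s).
  pose (G := fun i s => (U i s * U i s - V i s * V i s) * (U (S i) s - V (S i) s)).
  assert (CX : forall i x, continuous (X i) x) by (intros; unfold X; cont).
  assert (CY : forall i x, continuous (Y i) x) by (intros; unfold Y; cont).
  assert (CG : forall i x, continuous (G i) x) by (intros; unfold G; cont).
  set (n := S j). fold (X n) (X (S n)) (Y n) (Y (S n)) (G n).
  assert (PX : forall i, 0 <= RInt (X (S i)) 0 t <= RInt (X (S i)) 0 T).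
  { intros i. apply (RInt_nonneg_le_mono (X (S i)) t T); [apply CX | |lra].
    intros x. specialize (PU i x). unfold X. repeat apply Rmult_le_pos; lra. }
  assert (PY : forall i, 0 <= RInt (Y (S i)) 0 t <= RInt (Y (S i)) 0 T).
  { intros i. apply (RInt_nonneg_le_mono (Y (S i)) t T); [apply CY | |lra].
    intros x. specialize (PV i x). unfold Y. repeat apply Rmult_le_pos; lra. }
  assert (M : RInt (fun s => - G n s) 0 t <=
     RInt (fun s => 1 * (1 * X n s + 1 * X (S n) s) + 1 * (1 * Y n s + 1 * Y (S n) s)) 0 t).
  { apply RInt_le; [lra | | |].
    - apply ex_RInt_everywhere_continuous; intros; cont.
    - apply ex_RInt_everywhere_continuous; intros; cont.
    - intros x _. unfold G, X, Y, n.
      pose proof (PU j x) as a. pose proof (PU (S j) x) as b.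
      pose proof (PV j x) as a'. pose proof (PV (S j) x) as b'.
      pose proof (sqr_mul_le_cubes _ _ a b'). pose proof (sqr_mul_le_cubes _ _ a' b).
      assert (0 <= U (S j) x * U (S j) x * U (S (S j)) x) by (repeat apply Rmult_le_pos; lra).
      assert (0 <= V (S j) x * V (S j) x * V (S (S j)) x) by (repeat apply Rmult_le_pos; lra).
      lra. }
  assert (O : RInt (fun s => - G n s) 0 t = - RInt (G n) 0 t).
  { apply (RInt_opp (V := R_CompleteNormedModule)).
    now apply ex_RInt_everywhere_continuous. }
  rewrite O in M.
  rewrite (RInt_linear_combination 1 1 (fun s => 1 * X n s + 1 * X (S n) s)) in M
    by (intros; cont).
  rewrite !(RInt_linear_combination 1 1) in M by (intros; cont).
  pose proof (PX j) as X1. pose proof (PX n) as X2.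
  pose proof (PY j) as Y1. pose proof (PY n) as Y2. fold n in X1, Y1.
  assert (Hqn : 0 < q ^ n) by (apply pow_lt; lra).
  assert (Hh : 0 < (/ 2) ^ n) by (apply pow_lt; lra).
  assert (Q1 : q ^ n <= q ^ S n).
  { change (q ^ S n) with (q * q ^ n).
    rewrite <- (Rmult_1_l (q ^ n)) at 1. apply Rmult_le_compat_r; lra. }
  apply Rle_trans with ((/ 2) ^ n * (q ^ n * - RInt (G n) 0 t)); [lra|].
  apply Rmult_le_compat_l; [lra|].
  apply Rle_trans with
    (q ^ n * (RInt (X n) 0 T + RInt (Y n) 0 T
              + (RInt (X (S n)) 0 T + RInt (Y (S n)) 0 T))).
  - apply Rmult_le_compat_l; lra.
  - assert (q ^ n * (RInt (X (S n)) 0 T + RInt (Y (S n)) 0 T)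
      <= q ^ S n * (RInt (X (S n)) 0 T + RInt (Y (S n)) 0 T)) by (apply Rmult_le_compat_r; lra).
    lra.
Qed.

(** The equation of the mode [0] is only needed for the difference of the two
    solutions, from which the noise has disappeared. *)
Lemma positive_cascade_unique q T U V : 1 <= q -> 0 <= T ->
  positive_cascade q T U -> positive_cascade q T V ->
  ell2 (fun j => U j 0) ->
  (forall j, U j 0 = V j 0) ->
  (forall x, 0 < x < T -> is_derive (fun y => U 0%nat y - V 0%nat y) x
     (- (U 1%nat x * U 0%nat x - V 1%nat x * V 0%nat x))) ->
  forall t, 0 <= t <= T -> forall j, U j t = V j t.
Proof.
  intros Hq HT HU HV HE H0 HD t Ht.
  assert (HE' : ell2 (fun j => V j 0)).
  { apply ex_series_ext with (2 := HE). intros n; cbv beta. now rewrite H0. }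
  destruct (cube_integral_bound q T U Hq HT HU HE) as [B HB].
  destruct (cube_integral_bound q T V Hq HT HV HE') as [B' HB'].
  assert (Base : (U 0%nat t - V 0%nat t) ^ 2 + gap_flux q U V 0 t <= 0).
  { unfold gap_flux.
    pose proof HU as [CU PU DU]. pose proof HV as [CV PV DV].
    pose (dZ := fun x => - (U 1%nat x * U 0%nat x - V 1%nat x * V 0%nat x)).
    pose (G := fun s => (U 0%nat s * U 0%nat s - V 0%nat s * V 0%nat s) * (U 1%nat s - V 1%nat s)).
    assert (CG : forall x, continuous G x) by (intros; unfold G; cont).
    fold G.
    assert (M : (U 0%nat t - V 0%nat t) * (U 0%nat t - V 0%nat t)
      - (U 0%nat 0 - V 0%nat 0) * (U 0%nat 0 - V 0%nat 0) <=
      RInt (fun s => - G s) 0 t).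
    { apply (increment_le_RInt (fun x => (U 0%nat x - V 0%nat x) * (U 0%nat x - V 0%nat x))
        (fun x => dZ x * (U 0%nat x - V 0%nat x) + (U 0%nat x - V 0%nat x) * dZ x) _ T t).
      - intros x Hx.
        apply (is_derive_mult (fun y => U 0%nat y - V 0%nat y) (fun y => U 0%nat y - V 0%nat y));
          [now apply HD | now apply HD |]. intros; apply Rmult_comm.
      - intros; cont.
      - intros; cont.
      - intros x. unfold dZ, G.
        assert (0 <= (U 1%nat x + V 1%nat x) * ((U 0%nat x - V 0%nat x) * (U 0%nat x - V 0%nat x))).
        { specialize (PU 0%nat x). specialize (PV 0%nat x).
          apply Rmult_le_pos; [lra | apply Rle_0_sqr]. }
        lra.
      - exact Ht. }
    assert (O : RInt (fun s => - G s) 0 t = - RInt G 0 t).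
    { apply (RInt_opp (V := R_CompleteNormedModule)).
      now apply ex_RInt_everywhere_continuous. }
    rewrite O, (H0 0%nat) in M. simpl. lra. }
  assert (Step : forall j, gap_flux q U V (S j) t <= gap_flux q U V j t).
  { intros j. pose proof (gap_step q T U V j t ltac:(lra) HU HV (H0 (S j)) Ht).
    assert (0 <= (/ 2) ^ S j * (U (S j) t - V (S j) t) ^ 2)
      by (apply Rmult_le_pos; [apply pow_le; lra | apply pow2_ge_0]).
    lra. }
  assert (Mono : forall j k, gap_flux q U V (j + k) t <= gap_flux q U V j t).
  { intros j k. induction k.
    - rewrite Nat.add_0_r. lra.
    - rewrite Nat.add_succ_r. specialize (Step (j + k)%nat). lra. }
  assert (Gap : forall j, (/ 2) ^ j * (U j t - V j t) ^ 2 <= - gap_flux q U V j t).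
  { intros [|j].
    - simpl in *. lra.
    - pose proof (gap_step q T U V j t ltac:(lra) HU HV (H0 (S j)) Ht).
      pose proof (Mono 0%nat j). simpl (0 + j)%nat in *.
      pose proof (pow2_ge_0 (U 0%nat t - V 0%nat t)). lra. }
  (* A negative value would persist along [k >= j] by monotonicity, whereas
     [gap_flux_lower] bounds the values from below by [- 2^-k C]. *)
  assert (Low : forall j, 0 <= gap_flux q U V j t).
  { intros j. apply Rnot_lt_le. intros Hneg.
    set (g := - gap_flux q U V j t).
    set (C := Rabs (2 * B + 2 * B') + 1).
    assert (HC : 0 < C) by (unfold C; pose proof (Rabs_pos (2 * B + 2 * B')); lra).
    destruct (pow_lt_1_zero (/ 2)) with (y := g / C) as [N HN].
    - rewrite Rabs_pos_eq; lra.
    - apply Rdiv_lt_0_compat; unfold g; lra.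
    - specialize (HN (S (j + N)) ltac:(lia)).
      assert (Hp : 0 < (/ 2) ^ S (j + N)) by (apply pow_lt; lra).
      rewrite Rabs_pos_eq in HN by lra.
      apply (Rmult_lt_compat_r C) in HN; [|lra].
      unfold Rdiv in HN. rewrite Rmult_assoc, Rinv_l, Rmult_1_r in HN by lra.
      pose proof (gap_flux_lower q T U V (j + N) t Hq HU HV Ht) as L.
      pose proof (Mono j (S N)) as M. rewrite Nat.add_succ_r in M.
      pose proof (HB (j + N)%nat). pose proof (HB (S (j + N))).
      pose proof (HB' (j + N)%nat). pose proof (HB' (S (j + N))).
      pose proof (Rle_abs (2 * B + 2 * B')).
      assert ((/ 2) ^ S (j + N) *
        (cube_integral q U (S (j + N)) T + cube_integral q U (S (S (j + N))) T +
         (cube_integral q V (S (j + N)) T + cube_integral q V (S (S (j + N))) T))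
        <= (/ 2) ^ S (j + N) * C)
        by (apply Rmult_le_compat_l; unfold C; lra).
      unfold g in HN. lra. }
  intros j. specialize (Gap j). specialize (Low j).
  assert (Hp : 0 < (/ 2) ^ j) by (apply pow_lt; lra).
  pose proof (pow2_ge_0 (U j t - V j t)).
  assert ((U j t - V j t) ^ 2 = 0) by nra.
  assert (U j t - V j t = 0) by nra.
  lra.
Qed.

(** * Extension of solutions beyond the time interval *)

(** The projection of the real line onto [[0,T]], for [0 <= T]. *)
Definition clamp (T t : R) : R := Rmax 0 (Rmin T t).

Lemma clamp_in T t : 0 <= T -> Icc 0 T (clamp T t).
Proof.
  intros HT. unfold Icc, clamp.
  split; [apply Rmax_l | apply Rmax_lub; [lra | apply Rmin_l]].
Qed.

Lemma clamp_id T t : Icc 0 T t -> clamp T t = t.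
Proof. intros [H1 H2]. unfold clamp. rewrite Rmin_right, Rmax_right; lra. Qed.

Lemma clamp_lipschitz T s t : 0 <= T -> Rabs (clamp T s - clamp T t) <= Rabs (s - t).
Proof.
  intros HT. unfold clamp, Rmax, Rmin, Rabs.
  repeat (destruct Rle_dec || destruct Rcase_abs); lra.
Qed.

Lemma continuous_comp_clamp T (f : R -> R) : 0 <= T ->
  continuous_on (Icc 0 T) f -> forall x, continuous (fun t => f (clamp T t)) x.
Proof.
  intros HT Hf x P HP.
  destruct (Hf (clamp T x) (clamp_in T x HT) P HP) as [e He].
  exists e. intros y Hy. apply He; [|now apply clamp_in].
  eapply Rle_lt_trans; [apply (clamp_lipschitz T y x HT) | exact Hy].
Qed.

Lemma locally_clamp_id T x : 0 < x < T -> locally x (fun y => y = clamp T y).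
Proof.
  intros Hx. assert (He : 0 < Rmin x (T - x)) by (apply Rmin_glb_lt; lra).
  exists (mkposreal _ He). intros y Hy.
  change (Rabs (y - x) < Rmin x (T - x)) in Hy.
  pose proof (Rmin_l x (T - x)). pose proof (Rmin_r x (T - x)).
  apply Rabs_def2 in Hy. rewrite clamp_id; [reflexivity | unfold Icc; lra].
Qed.

Lemma D_in_is_derive_interior T (f d : R -> R) x :
  0 < x < T -> D_in f d (Icc 0 T) x -> is_derive f x (d x).
Proof.
  intros Hx HD. apply is_derive_Reals. intros eps Heps.
  destruct (HD eps Heps) as [a [Ha H]].
  assert (He : 0 < Rmin a (Rmin x (T - x))) by (repeat apply Rmin_glb_lt; lra).
  exists (mkposreal _ He). intros h Hh Hlt. simpl in Hlt.
  pose proof (Rmin_l a (Rmin x (T - x))). pose proof (Rmin_r a (Rmin x (T - x))).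
  pose proof (Rmin_l x (T - x)). pose proof (Rmin_r x (T - x)).
  specialize (H (x + h)). simpl in H. unfold Rdist in H.
  replace (x + h - x) with h in H by ring.
  apply H. split; [|lra].
  apply Rabs_def2 in Hlt.
  split; [unfold Icc; lra | lra].
Qed.

Lemma Rpower_2_mult_INR c j : Rpower 2 (c * INR j) = Rpower 2 c ^ j.
Proof. rewrite <- Rpower_mult. apply Rpower_pow. apply exp_pos. Qed.

Lemma positive_cascade_clamp c sigma T u0 w u : 0 <= T ->
  dyadic_solution c sigma T u0 w u ->
  positive_cascade (Rpower 2 c) T (fun j t => u (clamp T t) j).
Proof.
  intros HT [_ Hd _ Hc HH]. split.
  - intros j. exact (continuous_comp_clamp T (fun t => u t j) HT (Hc j)).
  - intros j x. apply (HH (clamp T x) (clamp_in T x HT)). lia.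
  - intros j x Hx.
    assert (Ix : Icc 0 T x) by (unfold Icc; lra).
    rewrite (clamp_id T x Ix).
    apply (is_derive_ext_loc (fun s => u s (S j))).
    { generalize (locally_clamp_id T x Hx). apply filter_imp. intros y <-. reflexivity. }
    assert (Hj : (1 <= S j)%nat) by lia.
    pose proof (D_in_is_derive_interior T _ _ x Hx (Hd (S j) Hj x Ix)) as H.
    cbv beta in H.
    replace (c * (INR (S j) - 1)) with (c * INR j) in H by (rewrite S_INR; ring).
    rewrite !Rpower_2_mult_INR in H.
    replace (S j + 1)%nat with (S (S j)) in H by lia.
    replace (S j - 1)%nat with j in H by lia.
    replace (u x j * u x j) with (u x j ^ 2) by ring.
    exact H.
Qed.

(** * Uniqueness for the dyadic system *)

Theorem corollary2p1 (c T sigma : R) (hc : 1 <= c < 3) (hT : 0 <= T)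
    (hsigma : 0 <= sigma)
    (u0 : nat -> R) (hu0 : H_plus u0)
    (w : R -> R) (hw : continuous_on (Icc 0 T) w) (hw0 : w 0 = 0)
    (u v : R -> nat -> R)
    (hu : dyadic_solution c sigma T u0 w u)
    (hv : dyadic_solution c sigma T u0 w v) :
  forall t : R, Icc 0 T t -> forall j : nat, u t j = v t j.
Proof.
  pose (U := fun j t => u (clamp T t) j).
  pose (V := fun j t => v (clamp T t) j).
  assert (HU : positive_cascade (Rpower 2 c) T U)
    by exact (positive_cascade_clamp c sigma T u0 w u hT hu).
  assert (HV : positive_cascade (Rpower 2 c) T V)
    by exact (positive_cascade_clamp c sigma T u0 w v hT hv).
  assert (I0 : Icc 0 T 0) by (unfold Icc; lra).
  assert (Hq : 1 <= Rpower 2 c).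
  { rewrite <- (Rpower_O 2) by lra. apply Rle_Rpower; lra. }
  assert (HU0 : forall j, U j 0 = u0 j)
    by (intros; unfold U; rewrite (clamp_id T 0 I0); apply hu).
  assert (HV0 : forall j, V j 0 = u0 j)
    by (intros; unfold V; rewrite (clamp_id T 0 I0); apply hv).
  intros t Ht j.
  rewrite <- (clamp_id T t Ht).
  apply (positive_cascade_unique (Rpower 2 c) T U V); try assumption.
  - apply ex_series_ext with (2 := proj1 hu0). intros n; cbv beta. now rewrite HU0.
  - intros i. now rewrite HU0, HV0.
  - pose proof HU as [CU _ _]. pose proof HV as [CV _ _].
    (* The noise terms [sigma * w x] cancel. *)
    assert (Zero : forall x, Icc 0 T x -> U 0%nat x - V 0%nat x =
      - RInt (fun s => 1 * (U 1%nat s * U 0%nat s) + -1 * (V 1%nat s * V 0%nat s)) 0 x).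
    { intros x Hx. rewrite RInt_linear_combination by (intros; cont).
      assert (E : forall (y : R -> nat -> R),
        RInt (fun s => y s 1%nat * y s 0%nat) 0 x =
        RInt (fun s => y (clamp T s) 1%nat * y (clamp T s) 0%nat) 0 x).
      { intros y. apply RInt_ext. intros s Hs.
        rewrite Rmin_left, Rmax_right in Hs by apply Hx.
        rewrite clamp_id; [reflexivity | unfold Icc in *; lra]. }
      pose proof (dyadic_zero _ _ _ _ _ _ hu x Hx) as Eu.
      pose proof (dyadic_zero _ _ _ _ _ _ hv x Hx) as Ev.
      rewrite E in Eu, Ev.
      rewrite (dyadic_init _ _ _ _ _ _ hu) in Eu.
      rewrite (dyadic_init _ _ _ _ _ _ hv) in Ev.
      unfold U at 1, V at 1. rewrite (clamp_id T x Hx), Eu, Ev.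
      unfold U, V. lra. }
    intros x Hx.
    apply (is_derive_ext_loc
      (fun y => - RInt (fun s => 1 * (U 1%nat s * U 0%nat s) + -1 * (V 1%nat s * V 0%nat s)) 0 y)).
    + generalize (locally_clamp_id T x Hx). apply filter_imp. intros y Hy.
      symmetry. apply Zero. rewrite Hy. now apply clamp_in.
    + replace (U 1%nat x * U 0%nat x - V 1%nat x * V 0%nat x)
        with (1 * (U 1%nat x * U 0%nat x) + -1 * (V 1%nat x * V 0%nat x)) by ring.
      apply (is_derive_opp (V := R_NormedModule)
        (RInt (fun s => 1 * (U 1%nat s * U 0%nat s) + -1 * (V 1%nat s * V 0%nat s)) 0)).
      apply (is_derive_RInt_everywhere_continuous
        (fun s => 1 * (U 1%nat s * U 0%nat s) + -1 * (V 1%nat s * V 0%nat s))).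
      intros; cont.
Qed.
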